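(* Let $\beta>0$, $\omega>0$, $\alpha\in[0,3/2]$ and $\Omega=\{(u,v)\in\mathbb{R}^2:u\ge0,\ v\in\mathbb{R}\}$. The unique critical point $(u_{\mathrm{cr}},v_{\mathrm{cr}})=(1/2,0)$ of the system $$u'=v,\qquad v'=1-\frac{\beta}{\sqrt{\omega}}\,v-\sqrt{2u}$$ is asymptotically stable for all trajectories starting inside the set $$\Omega_0=\Big\{(u,v)\in\Omega:\ \frac12v^2-u+\frac{2\sqrt2}{3}u^{3/2}+\frac16\le C\Big\},$$ where $C$ is the constant $$C=-\frac12\alpha^2+\frac{2\sqrt2}{3}\,\frac{\alpha^2}{2}\sqrt{\frac{\alpha^2}{2}}+\frac16 .$$
   Context: The prime denotes differentiation with respect to $s$; the system is considered on $\Omega$, and a trajectory is a solution $s\in[0,\infty)\mapsto(u(s),v(s))\in\Omega$. ''Asymptotically stable for all trajectories starting inside $\Omega_0$'' means that the critical point is Lyapunov stable with respect to trajectories starting in $\Omega_0$ and that every trajectory with $(u(0),v(0))\in\Omega_0$ satisfies $(u(s),v(s))\to(1/2,0)$ as $s\to\infty$ (i.e. $\Omega_0$ is contained in the basin of attraction). *)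

(* Defs.v *)
From Stdlib Require Export Reals.
From Coquelicot Require Export Coquelicot.
Open Scope R_scope.

(* [D_in] is the derivative relative to a set, so it is one-sided at s = 0,
   and the values of x on s < 0 are irrelevant. *)
Definition trajectory (F : R * R -> R * R) (Omega : R * R -> Prop)
    (x : R -> R * R) : Prop :=
  forall s : R, 0 <= s ->
    Omega (x s) /\
    D_in (fun t => fst (x t)) (fun t => fst (F (x t))) (fun t => 0 <= t) s /\
    D_in (fun t => snd (x t)) (fun t => snd (F (x t))) (fun t => 0 <= t) s.

Definition critical_point (F : R * R -> R * R) (Omega : R * R -> Prop)
    (p : R * R) : Prop :=
  Omega p /\ F p = (0, 0).

(* Coquelicot's norm on R * R is the Euclidean one. *)
Definition dist2 (p q : R * R) : R := norm (minus p q).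

Definition lyapunov_stable_from (F : R * R -> R * R)
    (Omega Omega0 : R * R -> Prop) (p : R * R) : Prop :=
  forall eps : R, 0 < eps ->
  exists delta : R, 0 < delta /\
    forall x : R -> R * R, trajectory F Omega x -> Omega0 (x 0) ->
      dist2 (x 0) p < delta ->
      forall s : R, 0 <= s -> dist2 (x s) p < eps.

Definition attractive_from (F : R * R -> R * R)
    (Omega Omega0 : R * R -> Prop) (p : R * R) : Prop :=
  forall x : R -> R * R, trajectory F Omega x -> Omega0 (x 0) ->
    filterlim x (Rbar_locally p_infty) (locally p).

Definition asymptotically_stable_from (F : R * R -> R * R)
    (Omega Omega0 : R * R -> Prop) (p : R * R) : Prop :=
  lyapunov_stable_from F Omega Omega0 p /\ attractive_from F Omega Omega0 p.

Definition half_plane (p : R * R) : Prop := 0 <= fst p.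

Definition vector_field (beta omega : R) (p : R * R) : R * R :=
  (snd p, 1 - beta / sqrt omega * snd p - sqrt (2 * fst p)).

(* u^(3/2) for u >= 0; [Rpower u (3/2)] would give 1 instead of 0 at u = 0. *)
Definition pow_3_2 (u : R) : R := u * sqrt u.

Definition energy (p : R * R) : R :=
  1 / 2 * snd p ^ 2 - fst p + 2 * sqrt 2 / 3 * pow_3_2 (fst p) + 1 / 6.

Definition level (alpha : R) : R :=
  - (1 / 2) * alpha ^ 2
  + 2 * sqrt 2 / 3 * (alpha ^ 2 / 2) * sqrt (alpha ^ 2 / 2) + 1 / 6.

Definition start_set (alpha : R) (p : R * R) : Prop :=
  half_plane p /\ energy p <= level alpha.

(* Main.v *)
Require Import Defs.
From Stdlib Require Import Lra.

(** Write [b = beta / sqrt omega > 0] for the friction coefficient and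
    [w = u - 1/2].  The energy [E] only satisfies [E' = - b v^2], which does not
    see the displacement [w].  Adding a cross term gives
      [W = E + (b/2) (w v + (b/2) w^2)],
    for which, along every trajectory,
      [W' = - (b/2) (v^2 + w (sqrt (2 u) - 1))].
    With [r = sqrt (2 u)], everything that depends on [u] alone is a polynomial
    in [r]: the potential is [(r - 1)^2 (2 r + 1) / 6], [w = (r^2 - 1) / 2] and
    [w (r - 1) = (r - 1)^2 (r + 1) / 2].  Hence, on the whole half plane, [W]
    lies between two positive multiples of [v^2 + w^2] ([lyapunov_lower],
    [lyapunov_upper]); as [W] does not increase, stability follows.  Each
    trajectory is therefore bounded, so [r <= M] along it for some [M]; then
    [v^2 + w (r - 1)] dominates a multiple of [W] ([dissipation_lower]), and the
    resulting inequality [W' <= - k W] with [k > 0] forces [W] to tend to [0],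
    which is attraction.

    This holds for every trajectory that stays in the half plane, wherever it
    starts, so stability and attraction are proved for an arbitrary set of
    starting points. *)

(** * One-sided derivatives on the half line *)

(** A function differentiable relative to [[0, +oo)] can be continued by its
    tangent at [0], so as to be differentiable in the ordinary sense at every
    [s >= 0]. *)
Lemma extend_half_line_derivative (f df : R -> R) :
  (forall s, 0 <= s -> D_in f df (fun t => 0 <= t) s) ->
  exists g : R -> R,
    (forall s, 0 <= s -> g s = f s) /\
    (forall s, 0 <= s -> is_derive g s (df s)).
Proof.
  intros Hf.
  exists (fun t => if Rle_dec 0 t then f t else f 0 + t * df 0); split.
  - intros s Hs; destruct (Rle_dec 0 s); [reflexivity | lra].
  - intros s Hs; apply is_derive_Reals; intros eps Heps.
    destruct (Hf s Hs eps Heps) as [d [Hd Hlim]].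
    assert (Hd' : 0 < (if Rle_dec s 0 then d else Rmin d s)).
    { destruct (Rle_dec s 0); [lra | apply Rmin_pos; lra]. }
    exists (mkposreal _ Hd'); simpl; intros h Hh Hhd.
    assert (Hhd1 : Rabs h < d).
    { destruct (Rle_dec s 0); [lra |].
      apply Rlt_le_trans with (1 := Hhd); apply Rmin_l. }
    destruct (Rle_dec 0 s) as [_ | n]; [| lra].
    destruct (Rle_dec 0 (s + h)) as [Hsh | Hsh].
    + specialize (Hlim (s + h)); simpl in Hlim; unfold Rdist, D_x in Hlim.
      replace (s + h - s) with h in Hlim by ring.
      apply Hlim; repeat split; trivial; lra.
    + (* Only at s = 0 can s + h leave the half line. *)
      assert (s = 0).
      { destruct (Rle_dec s 0); [lra |].
        assert (Rabs h < s)
          by (apply Rlt_le_trans with (1 := Hhd); apply Rmin_r).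
        apply Rabs_def2 in H; lra. }
      subst s.
      replace ((f 0 + (0 + h) * df 0 - f 0) / h - df 0) with 0 by (field; trivial).
      rewrite Rabs_R0; trivial.
Qed.

Lemma nonincreasing_from_0 (f df : R -> R) :
  (forall s, 0 <= s -> is_derive f s (df s)) ->
  (forall s, 0 <= s -> df s <= 0) ->
  forall s, 0 <= s -> f s <= f 0.
Proof.
  intros Hd Hn s Hs.
  destruct (MVT_gen f 0 s df) as [c [Hc Heq]].
  - intros t Ht; rewrite Rmin_left in Ht by trivial; apply Hd; lra.
  - intros t Ht; rewrite Rmin_left in Ht by trivial.
    apply continuity_pt_filterlim, (ex_derive_continuous f).
    exists (df t); apply Hd; lra.
  - rewrite Rmin_left in Hc by trivial.
    specialize (Hn c (proj1 Hc)); nra.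
Qed.

(** Gronwall's inequality, with the exponential rate weakened to
    [1 / (1 + k s)]. *)
Lemma decay_from_differential_inequality (f df : R -> R) (k : R) :
  0 < k ->
  (forall s, 0 <= s -> is_derive f s (df s)) ->
  (forall s, 0 <= s -> 0 <= f s) ->
  (forall s, 0 <= s -> df s <= - k * f s) ->
  forall s, 0 <= s -> f s * (1 + k * s) <= f 0.
Proof.
  intros Hk Hd Hf Hdf s Hs.
  assert (H : f s * exp (k * s) <= f 0 * exp (k * 0)).
  { apply (nonincreasing_from_0 (fun t => f t * exp (k * t))
      (fun t => (df t + k * f t) * exp (k * t))); trivial.
    - intros t Ht; pose proof (Hd t Ht) as Hdt.
      auto_derive.
      + exists (df t); exact Hdt.
      + replace (Derive (fun x => f x) t) with (df t)
          by (symmetry; apply is_derive_unique, Hdt).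
        ring.
    - intros t Ht; specialize (Hdf t Ht).
      pose proof (exp_pos (k * t)); nra. }
  rewrite Rmult_0_r, exp_0 in H.
  assert (He : 1 + k * s <= exp (k * s)).
  { destruct (Req_dec (k * s) 0) as [E | E].
    - rewrite E, exp_0; lra.
    - left; apply exp_ineq1; trivial. }
  specialize (Hf s Hs); nra.
Qed.

(** * The Lyapunov function *)

(** Energy plus a cross term between displacement and velocity; [b] is the
    friction coefficient. *)
Definition lyapunov (b : R) (p : R * R) : R :=
  energy p + b / 2 * ((fst p - 1 / 2) * snd p + b / 2 * (fst p - 1 / 2) ^ 2).

(** Minus the derivative of [lyapunov] along the flow, up to the factor
    [b / 2]. *)
Definition dissipation (p : R * R) : R :=
  snd p ^ 2 + (fst p - 1 / 2) * (sqrt (2 * fst p) - 1).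

(** The derivative is two-sided, also at [0], because [sqrt] vanishes on the
    negative half line. *)
Lemma is_derive_pow_3_2 (u : R) :
  0 <= u -> is_derive pow_3_2 u (3 / 2 * sqrt u).
Proof.
  intros [Hu | <-].
  - unfold pow_3_2; auto_derive; trivial.
    assert (Hs : 0 < sqrt u) by (apply sqrt_lt_R0; trivial).
    pose proof (sqrt_sqrt u (Rlt_le _ _ Hu)) as E.
    rewrite <- E at 2; field; lra.
  - apply is_derive_Reals; intros eps Heps.
    assert (He : 0 < eps ^ 2) by nra.
    exists (mkposreal _ He); simpl; intros h Hh Hhd.
    unfold pow_3_2; rewrite sqrt_0, Rplus_0_l.
    replace ((h * sqrt h - 0 * 0) / h - 3 / 2 * 0) with (sqrt h)
      by (field; trivial).
    rewrite Rabs_pos_eq by apply sqrt_pos.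
    rewrite <- (sqrt_pow2 eps) by lra.
    destruct (Rle_dec 0 h).
    + apply sqrt_lt_1; try nra.
      rewrite Rabs_pos_eq in Hhd by trivial; simpl; lra.
    + rewrite sqrt_neg_0 by lra; apply sqrt_lt_R0; trivial.
Qed.

(** The substitution [u = r^2 / 2] makes the energy polynomial. *)
Lemma energy_sqrt (r v : R) :
  0 <= r ->
  energy (r ^ 2 / 2, v) = 1 / 2 * v ^ 2 + (r - 1) ^ 2 * (2 * r + 1) / 6.
Proof.
  intros Hr; unfold energy, pow_3_2; cbn [fst snd].
  assert (H : sqrt 2 * sqrt (r ^ 2 / 2) = r).
  { rewrite <- sqrt_mult by nra.
    replace (2 * (r ^ 2 / 2)) with (r ^ 2) by field.
    apply sqrt_pow2; trivial. }
  replace (2 * sqrt 2 / 3 * (r ^ 2 / 2 * sqrt (r ^ 2 / 2)))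
    with (r ^ 2 / 3 * (sqrt 2 * sqrt (r ^ 2 / 2))) by field.
  rewrite H; field.
Qed.

Lemma half_plane_sqrt (u : R) :
  0 <= u -> exists r, 0 <= r /\ u = r ^ 2 / 2 /\ sqrt (2 * u) = r.
Proof.
  intros Hu; exists (sqrt (2 * u)); repeat split.
  - apply sqrt_pos.
  - rewrite pow2_sqrt by lra; field.
Qed.

Lemma dissipation_nonneg (p : R * R) : half_plane p -> 0 <= dissipation p.
Proof.
  destruct p as [u v]; unfold half_plane, dissipation; cbn [fst snd].
  intros Hu; destruct (half_plane_sqrt u Hu) as [r [Hr [-> ->]]].
  replace (v ^ 2 + (r ^ 2 / 2 - 1 / 2) * (r - 1))
    with (v ^ 2 + (r - 1) ^ 2 * (r + 1) / 2) by field.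
  assert (0 <= (r - 1) ^ 2 * (r + 1))
    by (apply Rmult_le_pos; [apply pow2_ge_0 | lra]).
  pose proof (pow2_ge_0 v); lra.
Qed.

Lemma energy_nonneg (p : R * R) :
  half_plane p -> 1 / 2 * snd p ^ 2 <= energy p.
Proof.
  destruct p as [u v]; unfold half_plane; cbn [fst snd].
  intros Hu; destruct (half_plane_sqrt u Hu) as [r [Hr [-> _]]].
  rewrite energy_sqrt by trivial.
  assert (0 <= (r - 1) ^ 2 * (2 * r + 1))
    by (apply Rmult_le_pos; [apply pow2_ge_0 | lra]).
  lra.
Qed.

Lemma lyapunov_lower (b : R) (p : R * R) :
  half_plane p ->
  b ^ 2 * (fst p - 1 / 2) ^ 2 <= 8 * lyapunov b p /\
  snd p ^ 2 <= 8 * lyapunov b p.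
Proof.
  intros Hp; pose proof (energy_nonneg p Hp) as HE; unfold lyapunov.
  destruct p as [u v]; cbn [fst snd] in *.
  set (w := u - 1 / 2).
  pose proof (pow2_ge_0 (v + b * w / 2)).
  pose proof (pow2_ge_0 (v + b * w)).
  pose proof (pow2_ge_0 v).
  (* 4 v^2 + 4 b w v + 2 b^2 w^2 equals both (2 v + b w)^2 + (b w)^2 and
     2 (v + b w)^2 + 2 v^2. *)
  split; nra.
Qed.

Lemma lyapunov_upper (b : R) (p : R * R) :
  half_plane p ->
  lyapunov b p <= (2 + b ^ 2) * (snd p ^ 2 + (fst p - 1 / 2) ^ 2).
Proof.
  destruct p as [u v]; unfold half_plane, lyapunov; cbn [fst snd].
  intros Hu; destruct (half_plane_sqrt u Hu) as [r [Hr [-> _]]].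
  rewrite energy_sqrt by trivial.
  set (w := r ^ 2 / 2 - 1 / 2).
  assert (HV : (r - 1) ^ 2 * (2 * r + 1) / 6 <= 2 * w ^ 2).
  { replace (w ^ 2) with ((r - 1) ^ 2 * ((r + 1) ^ 2 / 4))
      by (unfold w; field).
    pose proof (pow2_ge_0 (r - 1)).
    assert (2 * r + 1 <= 3 * (r + 1) ^ 2) by nra.
    nra. }
  pose proof (pow2_ge_0 (v - b * w / 2)).
  pose proof (pow2_ge_0 (b * v)).
  pose proof (pow2_ge_0 (b * w)).
  pose proof (pow2_ge_0 v).
  nra.
Qed.

(** On a strip [sqrt (2 u) <= M] the dissipation controls the Lyapunov
    function itself. *)
Lemma dissipation_lower (b M : R) (p : R * R) :
  half_plane p -> sqrt (2 * fst p) <= M ->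
  lyapunov b p <= (1 + b ^ 2 * (M + 1)) * dissipation p.
Proof.
  destruct p as [u v]; unfold half_plane, lyapunov, dissipation;
    cbn [fst snd].
  intros Hu; destruct (half_plane_sqrt u Hu) as [r [Hr [-> ->]]]; intros HM.
  rewrite energy_sqrt by trivial.
  set (w := r ^ 2 / 2 - 1 / 2).
  set (g := w * (r - 1)).
  assert (Hg : g = (r - 1) ^ 2 * (r + 1) / 2) by (unfold g, w; field).
  assert (Hw : w ^ 2 = g * (r + 1) / 2) by (unfold g, w; field).
  pose proof (pow2_ge_0 (r - 1)) as Hr1.
  assert (Hg0 : 0 <= g) by (rewrite Hg; nra).
  assert (HV : (r - 1) ^ 2 * (2 * r + 1) / 6 <= g) by (rewrite Hg; nra).
  assert (HwM : 2 * w ^ 2 <= (M + 1) * g) by (rewrite Hw; nra).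
  assert (Hbw : b ^ 2 * (2 * w ^ 2) <= b ^ 2 * ((M + 1) * g))
    by (apply Rmult_le_compat_l; [apply pow2_ge_0 | trivial]).
  assert (Hbv : 0 <= b ^ 2 * ((M + 1) * v ^ 2)).
  { apply Rmult_le_pos; [apply pow2_ge_0 |].
    apply Rmult_le_pos; [lra | apply pow2_ge_0]. }
  pose proof (pow2_ge_0 (v - b * w / 2)).
  nra.
Qed.

(** * Trajectories *)

Lemma trajectory_components (F : R * R -> R * R) (Omega : R * R -> Prop)
    (x : R -> R * R) :
  trajectory F Omega x ->
  exists u v : R -> R, forall s, 0 <= s ->
    x s = (u s, v s) /\
    is_derive u s (fst (F (x s))) /\ is_derive v s (snd (F (x s))).
Proof.
  intros Hx.
  destruct (extend_half_line_derivative _ _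
    (fun s Hs => proj1 (proj2 (Hx s Hs)))) as [u [Hu Hdu]].
  destruct (extend_half_line_derivative _ _
    (fun s Hs => proj2 (proj2 (Hx s Hs)))) as [v [Hv Hdv]].
  exists u, v; intros s Hs; split; [| split; auto].
  rewrite Hu, Hv by trivial; apply surjective_pairing.
Qed.

Lemma lyapunov_along_trajectory (beta omega : R) (x : R -> R * R) :
  trajectory (vector_field beta omega) half_plane x ->
  let b := beta / sqrt omega in
  exists f : R -> R,
    (forall s, 0 <= s -> f s = lyapunov b (x s)) /\
    (forall s, 0 <= s -> is_derive f s (- (b / 2) * dissipation (x s))).
Proof.
  intros Hx b.
  destruct (trajectory_components _ _ x Hx) as [u [v Huv]].
  exists (fun s => lyapunov b (u s, v s)); split.
  - intros s Hs; rewrite (proj1 (Huv s Hs)); reflexivity.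
  - intros s Hs.
    pose proof (proj1 (Hx s Hs)) as Hpos.
    destruct (Huv s Hs) as [E [Hdu Hdv]]; rewrite E in *.
    unfold half_plane in Hpos; unfold vector_field in Hdu, Hdv.
    fold b in Hdv; cbn [fst snd] in *.
    pose proof (is_derive_comp pow_3_2 u s _ _
      (is_derive_pow_3_2 (u s) Hpos) Hdu) as Hp.
    unfold lyapunov, energy, dissipation; cbn [fst snd].
    pose (P := fun t => pow_3_2 (u t)).
    change (is_derive P s (scal (v s) (3 / 2 * sqrt (u s)))) in Hp.
    apply (is_derive_ext (fun t => 1 / 2 * v t ^ 2 - u t
      + 2 * sqrt 2 / 3 * P t + 1 / 6
      + b / 2 * ((u t - 1 / 2) * v t + b / 2 * (u t - 1 / 2) ^ 2)));
      [reflexivity |].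
    auto_derive.
    + repeat split; eexists; eassumption.
    + replace (Derive (fun x0 => P x0) s) with (v s * (3 / 2 * sqrt (u s)))
        by (symmetry; apply is_derive_unique, Hp).
      replace (Derive (fun x0 => u x0) s) with (v s)
        by (symmetry; apply is_derive_unique, Hdu).
      replace (Derive (fun x0 => v x0) s)
        with (1 - b * v s - sqrt (2 * u s))
        by (symmetry; apply is_derive_unique, Hdv).
      rewrite sqrt_mult by lra; field.
Qed.

Lemma lyapunov_nonincreasing (beta omega : R) (x : R -> R * R) :
  0 < beta / sqrt omega ->
  trajectory (vector_field beta omega) half_plane x ->
  forall s, 0 <= s ->
    lyapunov (beta / sqrt omega) (x s) <= lyapunov (beta / sqrt omega) (x 0).
Proof.
  intros Hb Hx s Hs.
  destruct (lyapunov_along_trajectory beta omega x Hx) as [f [Hf Hdf]].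
  rewrite <- (Hf s Hs), <- (Hf 0 (Rle_refl 0)).
  apply (nonincreasing_from_0 f _ Hdf); trivial.
  intros t Ht.
  pose proof (dissipation_nonneg _ (proj1 (Hx t Ht))); nra.
Qed.

Lemma lyapunov_decay (beta omega : R) (x : R -> R * R) :
  0 < beta / sqrt omega ->
  trajectory (vector_field beta omega) half_plane x ->
  exists k, 0 < k /\ forall s, 0 <= s ->
    lyapunov (beta / sqrt omega) (x s) * (1 + k * s)
      <= lyapunov (beta / sqrt omega) (x 0).
Proof.
  intros Hb Hx.
  pose proof (lyapunov_nonincreasing beta omega x Hb Hx) as Hmono.
  destruct (lyapunov_along_trajectory beta omega x Hx) as [f [Hf Hdf]].
  set (b := beta / sqrt omega) in *.
  set (D := 8 * lyapunov b (x 0) / b ^ 2).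
  assert (Hb2 : 0 < b ^ 2) by nra.
  (* With w = u - 1/2 and r = sqrt (2 u): w^2 <= D, u <= 1 + w^2 and
     r <= 1 + r^2 / 2 = 1 + u give r <= D + 2. *)
  assert (HM : forall s, 0 <= s -> sqrt (2 * fst (x s)) <= D + 2).
  { intros s Hs; pose proof (proj1 (Hx s Hs)) as Hp.
    destruct (lyapunov_lower b (x s) Hp) as [Hlow _].
    assert (HD : (fst (x s) - 1 / 2) ^ 2 <= D).
    { apply Rmult_le_reg_l with (1 := Hb2).
      replace (b ^ 2 * D) with (8 * lyapunov b (x 0)) by (unfold D; field; lra).
      specialize (Hmono s Hs); lra. }
    destruct (half_plane_sqrt _ Hp) as [r [Hr [Eu Er]]]; rewrite Er.
    pose proof (pow2_ge_0 (r - 1)).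
    pose proof (pow2_ge_0 (fst (x s) - 1 / 2 - 1 / 2)).
    nra. }
  assert (HD0 : 0 <= D + 2)
    by (apply Rle_trans with (2 := HM 0 (Rle_refl 0)); apply sqrt_pos).
  set (K := 1 + b ^ 2 * (D + 2 + 1)).
  assert (HK : 0 < K) by (unfold K; nra).
  exists (b / 2 / K); split.
  { apply Rdiv_lt_0_compat; lra. }
  intros s Hs.
  rewrite <- (Hf s Hs), <- (Hf 0 (Rle_refl 0)).
  apply (decay_from_differential_inequality f _ (b / 2 / K)) with (2 := Hdf);
    trivial.
  - apply Rdiv_lt_0_compat; lra.
  - intros t Ht; rewrite (Hf t Ht).
    destruct (lyapunov_lower b (x t) (proj1 (Hx t Ht))) as [_ H].
    pose proof (pow2_ge_0 (snd (x t))); lra.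
  - intros t Ht; rewrite (Hf t Ht).
    pose proof (dissipation_lower b (D + 2) (x t) (proj1 (Hx t Ht)) (HM t Ht))
      as Hdis; fold K in Hdis.
    replace (- (b / 2 / K) * lyapunov b (x t))
      with (- (b / 2) * (lyapunov b (x t) / K)) by (field; lra).
    assert (lyapunov b (x t) / K <= dissipation (x t)).
    { apply Rmult_le_reg_l with (1 := HK).
      replace (K * (lyapunov b (x t) / K)) with (lyapunov b (x t))
        by (field; lra).
      trivial. }
    nra.
Qed.

(** * Stability and attraction *)

Lemma dist2_critical_point (p : R * R) :
  dist2 p (1 / 2, 0) = sqrt (snd p ^ 2 + (fst p - 1 / 2) ^ 2).
Proof.
  destruct p as [u v].
  change (sqrt (Rabs (u + - (1 / 2)) ^ 2 + Rabs (v + - 0) ^ 2)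
          = sqrt (v ^ 2 + (u - 1 / 2) ^ 2)).
  rewrite !pow2_abs; f_equal; ring.
Qed.

Lemma Rabs_lt_of_pow2_lt (a e : R) : 0 < e -> a ^ 2 < e ^ 2 -> Rabs a < e.
Proof. intros He H; apply Rabs_def1; nra. Qed.

Lemma critical_point_unique (beta omega : R) :
  unique (critical_point (vector_field beta omega) half_plane) (1 / 2, 0).
Proof.
  unfold critical_point, half_plane, vector_field; split.
  - simpl; split; [lra |].
    replace (2 * (1 / 2)) with 1 by field; rewrite sqrt_1; f_equal; ring.
  - intros [u v] [Hu H]; simpl in Hu, H; injection H as Hv H.
    rewrite Hv in H |- *.
    destruct (half_plane_sqrt u Hu) as [r [_ [Eu Er]]].
    rewrite Er in H; f_equal; rewrite Eu.
    replace r with 1 by lra; field.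
Qed.

Lemma critical_point_stable (beta omega : R) (Omega0 : R * R -> Prop) :
  0 < beta / sqrt omega ->
  lyapunov_stable_from (vector_field beta omega) half_plane Omega0 (1 / 2, 0).
Proof.
  intros Hb eps Heps.
  set (b := beta / sqrt omega) in *.
  assert (Hb2 : 0 < b ^ 2) by nra.
  (* The ratio of the constants in the upper and lower bounds of the
     Lyapunov function by the squared distance. *)
  set (K := (8 + 8 / b ^ 2) * (2 + b ^ 2)).
  assert (H8 : 0 < 8 / b ^ 2) by (apply Rdiv_lt_0_compat; lra).
  assert (HK : 0 < K) by (apply Rmult_lt_0_compat; lra).
  assert (HsK : 0 < sqrt K) by (apply sqrt_lt_R0; trivial).
  exists (eps / sqrt K); split; [apply Rdiv_lt_0_compat; trivial |].
  intros x Hx _ Hx0 s Hs.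
  rewrite dist2_critical_point in *.
  pose proof (lyapunov_nonincreasing beta omega x Hb Hx s Hs) as Hmono.
  fold b in Hmono.
  destruct (lyapunov_lower b (x s) (proj1 (Hx s Hs))) as [Hw Hv].
  pose proof (lyapunov_upper b (x 0) (proj1 (Hx 0 (Rle_refl 0)))) as Hup.
  set (N0 := snd (x 0) ^ 2 + (fst (x 0) - 1 / 2) ^ 2) in *.
  assert (HN : snd (x s) ^ 2 + (fst (x s) - 1 / 2) ^ 2 <= K * N0).
  { assert (Hw' : (fst (x s) - 1 / 2) ^ 2 <= 8 / b ^ 2 * lyapunov b (x s)).
    { apply Rmult_le_reg_l with (1 := Hb2).
      replace (b ^ 2 * (8 / b ^ 2 * lyapunov b (x s)))
        with (8 * lyapunov b (x s)) by (field; lra).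
      trivial. }
    unfold K; rewrite Rmult_assoc.
    apply Rle_trans with ((8 + 8 / b ^ 2) * lyapunov b (x s)); [lra |].
    apply Rmult_le_compat_l; lra. }
  apply Rle_lt_trans with (sqrt (K * N0)); [apply sqrt_le_1_alt; trivial |].
  rewrite sqrt_mult_alt by lra.
  replace eps with (sqrt K * (eps / sqrt K)) by (field; lra).
  apply Rmult_lt_compat_l; trivial.
Qed.

Lemma critical_point_attractive (beta omega : R) (Omega0 : R * R -> Prop) :
  0 < beta / sqrt omega ->
  attractive_from (vector_field beta omega) half_plane Omega0 (1 / 2, 0).
Proof.
  intros Hb x Hx _.
  destruct (lyapunov_decay beta omega x Hb Hx) as [k [Hk Hdec]].
  set (b := beta / sqrt omega) in *.
  assert (Hb2 : 0 < b ^ 2) by nra.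
  set (L0 := lyapunov b (x 0)) in *.
  apply filterlim_locally; intros [eps Heps].
  set (c := Rmin 1 (b ^ 2)).
  assert (Hc : 0 < c) by (apply Rmin_pos; lra).
  assert (Hc1 : c <= 1) by apply Rmin_l.
  assert (Hcb : c <= b ^ 2) by apply Rmin_r.
  set (eta := c * eps ^ 2 / 8).
  assert (Hce : 0 < c * eps ^ 2)
    by (apply Rmult_lt_0_compat; [| apply pow_lt]; trivial).
  assert (Heta : 0 < eta) by (unfold eta; lra).
  exists (Rmax 0 (L0 / (k * eta))); intros s Hs.
  assert (Hs0 : 0 < s) by (apply Rle_lt_trans with (2 := Hs); apply Rmax_l).
  assert (HsL : L0 / (k * eta) < s)
    by (apply Rle_lt_trans with (2 := Hs); apply Rmax_r).
  assert (Hke : 0 < k * eta) by nra.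
  assert (HL : L0 < s * (k * eta)) by (apply Rlt_div_l; trivial).
  specialize (Hdec s (Rlt_le _ _ Hs0)).
  assert (Hks : 0 < k * s) by nra.
  assert (Hsmall : lyapunov b (x s) < eta).
  { apply Rnot_le_lt; intros Habs; nra. }
  destruct (lyapunov_lower b (x s) (proj1 (Hx s (Rlt_le _ _ Hs0)))) as [Hw Hv].
  assert (Heps2 : 8 * eta = c * eps ^ 2) by (unfold eta; field).
  assert (Hw2 : (fst (x s) - 1 / 2) ^ 2 < eps ^ 2).
  { apply Rmult_lt_reg_l with (1 := Hc).
    pose proof (pow2_ge_0 (fst (x s) - 1 / 2)); nra. }
  assert (Hv2 : snd (x s) ^ 2 < eps ^ 2) by nra.
  split.
  - change (Rabs (fst (x s) - 1 / 2) < eps).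
    apply Rabs_lt_of_pow2_lt; trivial.
  - change (Rabs (snd (x s) - 0) < eps).
    rewrite Rminus_0_r; apply Rabs_lt_of_pow2_lt; trivial.
Qed.

Theorem theorem5p4 (beta omega alpha : R)
  (hbeta : 0 < beta) (homega : 0 < omega) (halpha : 0 <= alpha <= 3 / 2) :
  unique (critical_point (vector_field beta omega) half_plane) (1 / 2, 0) /\
  asymptotically_stable_from (vector_field beta omega) half_plane
    (start_set alpha) (1 / 2, 0).
Proof.
  assert (Hb : 0 < beta / sqrt omega)
    by (apply Rdiv_lt_0_compat; [| apply sqrt_lt_R0]; trivial).
  split; [apply critical_point_unique |].
  split; [apply critical_point_stable | apply critical_point_attractive];
    trivial.
Qed.
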